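(* Let $S$ be a Hausdorff topological semigroup containing the bicyclic semigroup $\mathcal C(p,q)$ as a dense subsemigroup. Then: (1) $S\setminus\mathcal C(p,q)$ is a two-sided ideal of $S$; (2) for every $c\in\mathcal C(p,q)$ the set $D_c=\{(x,y):x,y\in\mathcal C(p,q),\ xy=c\}$ is an open-and-closed discrete subspace of $S\times S$; (3) $S\times S$ is not pseudocompact; (4) if $S$ is Tychonoff, then its Stone–Čech compactification $\beta S$ is not openly factorizable; (5) the almost periodic compactification $\mathrm{AP}(S)$ of $S$ is a compact abelian topological group, and hence the canonical homomorphism $\eta:S\to\mathrm{AP}(S)$ is not injective.
   Context: The bicyclic semigroup $\mathcal C(p,q)$ is the semigroup with identity $1$ generated by $p,q$ subject to the single relation $qp=1$; every element is uniquely $p^nq^m$ ($n,m\in\omega$). A space is pseudocompact if every locally finite open cover is finite. A space $X$ is openly factorizable if every continuous map $f:X\to Y$ to a separable metrizable $Y$ factors as $f=g\circ p$ with $p:X\to K$ an open continuous surjection onto a separable metrizable $K$ and $g:K\to Y$ continuous. The almost periodic compactification of a semitopological semigroup $S$ is a pair $(\mathrm{AP}(S),\eta)$ where $\mathrm{AP}(S)$ is a compact Hausdorff topological semigroup and $\eta:S\to\mathrm{AP}(S)$ is a continuous homomorphism such that every continuous homomorphism $h:S\to K$ into a compact Hausdorff topological semigroup $K$ factors uniquely as $h=\bar h\circ\eta$ with $\bar h:\mathrm{AP}(S)\to K$ a continuous homomorphism. *)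

(* Defs.v *)
From Stdlib Require Import Reals List Classical.

Definition set (X : Type) := X -> Prop.

Definition is_topology {X : Type} (op : set X -> Prop) : Prop :=
  op (fun _ => True) /\
  (forall U V, op U -> op V -> op (fun x => U x /\ V x)) /\
  (forall F : set X -> Prop, (forall U, F U -> op U) ->
     op (fun x => exists U, F U /\ U x)).

Definition closed {X : Type} (op : set X -> Prop) (C : set X) : Prop :=
  op (fun x => ~ C x).

Definition continuous {X Y : Type} (opX : set X -> Prop) (opY : set Y -> Prop)
  (f : X -> Y) : Prop :=
  forall V, opY V -> opX (fun x => V (f x)).

Definition open_map {X Y : Type} (opX : set X -> Prop) (opY : set Y -> Prop)
  (f : X -> Y) : Prop :=
  forall U, opX U -> opY (fun y => exists x, U x /\ f x = y).

Definition surjective {X Y : Type} (f : X -> Y) : Prop := forall y, exists x, f x = y.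
Definition injective {X Y : Type} (f : X -> Y) : Prop := forall x y, f x = f y -> x = y.

Definition hausdorff {X : Type} (op : set X -> Prop) : Prop :=
  forall x y, x <> y -> exists U V, op U /\ op V /\ U x /\ V y /\
    (forall z, ~ (U z /\ V z)).

Definition finite_family {X : Type} (F : set X -> Prop) : Prop :=
  exists l : list (set X), forall U, F U -> In U l.

Definition open_cover {X : Type} (op : set X -> Prop) (F : set X -> Prop) : Prop :=
  (forall U, F U -> op U) /\ (forall x, exists U, F U /\ U x).

Definition compact {X : Type} (op : set X -> Prop) : Prop :=
  forall F : set X -> Prop, open_cover op F ->
    exists l : list (set X), (forall U, In U l -> F U) /\
      (forall x, exists U, In U l /\ U x).

Definition locally_finite {X : Type} (op : set X -> Prop) (F : set X -> Prop) : Prop :=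
  forall x, exists W, op W /\ W x /\
    finite_family (fun U => F U /\ exists y, W y /\ U y).

Definition pseudocompact {X : Type} (op : set X -> Prop) : Prop :=
  forall F : set X -> Prop, open_cover op F -> locally_finite op F -> finite_family F.

Definition prod_topology {X Y : Type} (opX : set X -> Prop) (opY : set Y -> Prop)
  : set (X * Y) -> Prop :=
  fun W => forall z, W z -> exists U V, opX U /\ opY V /\ U (fst z) /\ V (snd z) /\
    (forall a b, U a -> V b -> W (a, b)).

Definition dense {X : Type} (op : set X -> Prop) (D : set X) : Prop :=
  forall U, op U -> (exists x, U x) -> exists x, U x /\ D x.

Definition discrete_subspace {X : Type} (op : set X -> Prop) (D : set X) : Prop :=
  forall x, D x -> exists W, op W /\ W x /\ (forall y, W y -> D y -> y = x).

Definition countable_set {X : Type} (D : set X) : Prop :=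
  exists f : X -> nat, forall x y, D x -> D y -> f x = f y -> x = y.

Definition R_topology : set R -> Prop :=
  fun U => forall x, U x -> exists eps, (0 < eps)%R /\
    (forall y, (Rabs (y - x) < eps)%R -> U y).

Definition is_metric {Y : Type} (d : Y -> Y -> R) : Prop :=
  (forall x y, (0 <= d x y)%R) /\ (forall x y, d x y = 0%R <-> x = y) /\
  (forall x y, d x y = d y x) /\ (forall x y z, (d x z <= d x y + d y z)%R).

Definition metric_topology {Y : Type} (d : Y -> Y -> R) : set Y -> Prop :=
  fun U => forall x, U x -> exists eps, (0 < eps)%R /\
    (forall y, (d x y < eps)%R -> U y).

Definition separable_metrizable {Y : Type} (op : set Y -> Prop) : Prop :=
  (exists d, is_metric d /\ forall U, op U <-> metric_topology d U) /\
  (exists D : set Y, countable_set D /\ dense op D).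

Definition openly_factorizable {X : Type} (opX : set X -> Prop) : Prop :=
  forall (Y : Type) (opY : set Y -> Prop) (f : X -> Y),
    separable_metrizable opY -> continuous opX opY f ->
    exists (K : Type) (opK : set K -> Prop) (p : X -> K) (g : K -> Y),
      separable_metrizable opK /\ continuous opX opK p /\ open_map opX opK p /\
      surjective p /\ continuous opK opY g /\ (forall x, f x = g (p x)).

Definition tychonoff {X : Type} (op : set X -> Prop) : Prop :=
  (forall x : X, closed op (fun y => y = x)) /\
  (forall (C : set X) x, closed op C -> ~ C x ->
     exists f : X -> R, continuous op R_topology f /\ f x = 0%R /\
       (forall y, C y -> f y = 1%R)).

Definition stone_cech {X : Type} (opX : set X -> Prop)
  (B : Type) (opB : set B -> Prop) (e : X -> B) : Prop :=
  is_topology opB /\ compact opB /\ hausdorff opB /\ continuous opX opB e /\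
  forall (K : Type) (opK : set K -> Prop) (f : X -> K),
    is_topology opK -> compact opK -> hausdorff opK -> continuous opX opK f ->
    exists g : B -> K, continuous opB opK g /\ (forall x, g (e x) = f x) /\
      (forall g' : B -> K, continuous opB opK g' -> (forall x, g' (e x) = f x) ->
         forall b, g' b = g b).

Definition topological_semigroup {S : Type} (op : set S -> Prop) (mul : S -> S -> S)
  : Prop :=
  is_topology op /\ (forall a b c, mul (mul a b) c = mul a (mul b c)) /\
  continuous (prod_topology op op) op (fun z => mul (fst z) (snd z)).

Definition semigroup_hom {S T : Type} (mulS : S -> S -> S) (mulT : T -> T -> T)
  (h : S -> T) : Prop :=
  forall x y, h (mulS x y) = mulT (h x) (h y).

Definition ap_compactification {S : Type} (opS : set S -> Prop) (mulS : S -> S -> S)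
  (A : Type) (opA : set A -> Prop) (mulA : A -> A -> A) (eta : S -> A) : Prop :=
  topological_semigroup opA mulA /\ compact opA /\ hausdorff opA /\
  continuous opS opA eta /\ semigroup_hom mulS mulA eta /\
  forall (K : Type) (opK : set K -> Prop) (mulK : K -> K -> K) (h : S -> K),
    topological_semigroup opK mulK -> compact opK -> hausdorff opK ->
    continuous opS opK h -> semigroup_hom mulS mulK h ->
    exists hb : A -> K, continuous opA opK hb /\ semigroup_hom mulA mulK hb /\
      (forall s, hb (eta s) = h s) /\
      (forall hb' : A -> K, continuous opA opK hb' -> semigroup_hom mulA mulK hb' ->
         (forall s, hb' (eta s) = h s) -> forall a, hb' a = hb a).

Definition compact_abelian_topological_group {A : Type} (opA : set A -> Prop)
  (mulA : A -> A -> A) : Prop :=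
  topological_semigroup opA mulA /\ compact opA /\
  (forall x y, mulA x y = mulA y x) /\
  exists (e : A) (inv : A -> A),
    (forall x, mulA e x = x /\ mulA x e = x) /\
    (forall x, mulA (inv x) x = e /\ mulA x (inv x) = e) /\
    continuous opA opA inv.

(** The bicyclic semigroup C(p,q): p^a q^b is represented by (a,b);
    (p^a q^b)(p^c q^d) = p^(a + (c-b)) q^((b-c) + d) (truncated subtraction). *)
Definition bicyclic : Type := (nat * nat)%type.
Definition bmul (x y : bicyclic) : bicyclic :=
  ((fst x + (fst y - snd x))%nat, ((snd x - fst y) + snd y)%nat).

(* Main.v *)
Require Import Defs.
From Stdlib Require Import Reals List Classical.
From Stdlib Require Import Lia Lra Cantor FinFun ClassicalEpsilon.
From Stdlib Require Import FunctionalExtensionality PropExtensionality.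

(** For every [c] in [C(p,q)] the equations [a x = c] and [x a = c] have finitely many
    solutions in [C(p,q)]; together with density this makes the elements of [C(p,q)]
    isolated in [S] and gives (1), and then (2). The fibre [D_1] consists of the pairs
    [(q^n, p^n)]; it is infinite, clopen and discrete, which gives (3).

    (4) Map [C(p,q)] injectively into the isolated points of the one-point compactification
    of the integers, and the rest of [S] to infinity. If the extension of this map to
    [beta S] factors through an open map onto a metrizable space, every injective sequence
    in [C(p,q)] has a subsequence converging in [beta S]. The limit lies in [S], since
    otherwise the indicator function of the even terms of the subsequence would be
    continuous on [S] and extend to [beta S]. So [(q^n, p^n)] has a cluster point
    in [S * S], contradicting (2).

    (5) In [AP(S)] let [a], [b] be the images of [p], [q], so that [b a = 1]. A cluster point
    of the pairs [(a^n, b^n)] shows that [1] is in the closure of the powers [a^k], [k >= 1],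
    hence in the compact set [a AP(S)]; thus [a b = 1]. The image of [C(p,q)] is therefore
    a commutative group, and so is its closure [AP(S)]. *)

Lemma set_ext {X : Type} (U V : set X) : (forall x, U x <-> V x) -> U = V.
Proof.
  intros H. apply functional_extensionality. intros x.
  apply propositional_extensionality, H.
Qed.

Lemma sig_ext {X : Type} (P : X -> Prop) (x y : {x | P x}) :
  proj1_sig x = proj1_sig y -> x = y.
Proof.
  destruct x as [x hx], y as [y hy]; simpl. intros <-.
  now rewrite (proof_irrelevance _ hx hy).
Qed.

(** * Topological preliminaries *)

Section Topology.
Context {X : Type} (op : set X -> Prop) (Htop : is_topology op).

Lemma open_full : op (fun _ => True).
Proof. apply Htop. Qed.

Lemma open_inter (U V : set X) : op U -> op V -> op (fun x => U x /\ V x).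
Proof. apply Htop. Qed.

Lemma open_of_nbhds (P : set X) :
  (forall x, P x -> exists U, op U /\ U x /\ forall y, U y -> P y) -> op P.
Proof.
  intros H.
  replace P with (fun x => exists U, (op U /\ forall y, U y -> P y) /\ U x).
  - apply Htop. tauto.
  - apply set_ext. intros x. split.
    + intros (U & [_ HU] & Ux). auto.
    + intros Px. destruct (H x Px) as (U & ? & ? & ?). eauto.
Qed.

Lemma continuous_of_nbhds {Y : Type} (opY : set Y -> Prop) (f : X -> Y) :
  (forall x V, opY V -> V (f x) -> exists U, op U /\ U x /\ forall y, U y -> V (f y)) ->
  continuous op opY f.
Proof.
  intros H V HV. apply open_of_nbhds. intros x Vx. exact (H x V HV Vx).
Qed.

Context (Hh : hausdorff op).

Lemma open_neq {Y : Type} (opY : set Y -> Prop) (f g : X -> Y) :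
  hausdorff opY -> continuous op opY f -> continuous op opY g ->
  op (fun x => f x <> g x).
Proof.
  intros HY Hf Hg. apply open_of_nbhds. intros x Hx.
  destruct (HY _ _ Hx) as (U & V & HU & HV & Ux & Vx & HUV).
  exists (fun y => U (f y) /\ V (g y)). split; [|split].
  - apply open_inter; [apply Hf | apply Hg]; assumption.
  - now split.
  - intros y [H1 H2] E. apply (HUV (f y)). split; [|rewrite E]; assumption.
Qed.

Lemma open_neq_point (a : X) : op (fun x => x <> a).
Proof.
  apply open_of_nbhds. intros x Hx.
  destruct (Hh _ _ Hx) as (U & V & HU & HV & Ux & Va & HUV).
  exists U. repeat split; trivial. intros y Uy ->. apply (HUV a). now split.
Qed.

(** The predicate [P] selects which listed points are removed, so that a distinguished point such as
    [iota c] can be spared even if it occurs in the list. *)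
Lemma open_not_in (P : set X) (l : list X) :
  op (fun x => forall y, In y l -> P y -> x <> y).
Proof.
  induction l as [|a l IH].
  - replace (fun x : X => _) with (fun _ : X => True); [apply open_full|].
    apply set_ext. intros x. simpl. tauto.
  - destruct (classic (P a)) as [Pa | nPa].
    + replace (fun x : X => _)
        with (fun x => x <> a /\ forall y, In y l -> P y -> x <> y).
      * apply open_inter; [apply open_neq_point | exact IH].
      * apply set_ext. intros x. simpl. split.
        -- intros [H1 H2] y [<- | Hy] Py; auto.
        -- intros H. split; auto.
    + replace (fun x : X => _) with (fun x => forall y, In y l -> P y -> x <> y).
      * exact IH.
      * apply set_ext. intros x. simpl. split.
        -- intros H y [<- | Hy] Py; [contradiction | auto].
        -- auto.
Qed.

(* With an arbitrary filter base [Phi] in place of the tails of a sequence, this one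
   statement also yields closedness of projections along compact factors. *)
Lemma compact_cluster_point {I : Type} (Phi : set I -> Prop) (u : I -> X) :
  Defs.compact op -> Phi (fun _ => True) ->
  (forall M N, Phi M -> Phi N -> exists L, Phi L /\ forall i, L i -> M i /\ N i) ->
  (forall M, Phi M -> exists i, M i) ->
  exists x, forall V M, op V -> V x -> Phi M -> exists i, M i /\ V (u i).
Proof.
  intros Hc Hfull Hint Hne. apply NNPP. intros Hno.
  (* Without a cluster point, the open sets that [u] avoids along some member of [Phi] cover the
     space. A finite subcover is avoided along one common member, which is nonempty. *)
  destruct (Hc (fun V => op V /\ exists M, Phi M /\ forall i, M i -> ~ V (u i)))
    as (l & Hl & Hcov).
  { split; [tauto|]. intros x. apply NNPP. intros Hx. apply Hno. exists x.
    intros V M HV Vx HM. apply NNPP. intros HVM. apply Hx. exists V.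
    repeat split; trivial. exists M. split; trivial. intros i Mi Vi. eauto. }
  assert (HM : exists M, Phi M /\ forall V, In V l -> forall i, M i -> ~ V (u i)).
  { clear Hcov. induction l as [|V l IH].
    - exists (fun _ => True). split; [assumption|]. simpl. tauto.
    - destruct IH as (M & HM & HMl); [intros U HU; apply Hl; now right|].
      destruct (Hl V (or_introl eq_refl)) as (_ & N & HN & HNV).
      destruct (Hint M N HM HN) as (L & HL & HLMN).
      exists L. split; [assumption|]. intros W [<- | HW] i Li.
      + apply HNV, HLMN, Li.
      + apply (HMl W HW). apply HLMN, Li. }
  destruct HM as (M & HM & HMl). destruct (Hne M HM) as (i & Mi).
  destruct (Hcov (u i)) as (V & HV & Vi). exact (HMl V HV i Mi Vi).
Qed.

Lemma compact_sequence_cluster (u : nat -> X) :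
  Defs.compact op ->
  exists x, forall V, op V -> V x -> forall N, exists n, N <= n /\ V (u n).
Proof.
  intros Hc.
  destruct (compact_cluster_point (fun M => exists N, forall n, N <= n -> M n) u Hc)
    as (x & Hx).
  - exists 0. trivial.
  - intros M N (m & Hm) (n & Hn). exists (fun i => M i /\ N i). split; [|auto].
    exists (m + n). intros k Hk. split; [apply Hm | apply Hn]; lia.
  - intros M (m & Hm). exists m. auto.
  - exists x. intros V HV Vx N. apply (Hx V (fun n => N <= n) HV Vx). now exists N.
Qed.

End Topology.

(** * Subspaces *)

Definition subspace {X : Type} (op : set X -> Prop) (P : set X) : set {x | P x} -> Prop :=
  fun V => exists U, op U /\ forall z, V z <-> U (proj1_sig z).

Definition closure {X : Type} (op : set X -> Prop) (E : set X) : set X :=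
  fun x => forall U, op U -> U x -> exists y, U y /\ E y.

Section Subspace.
Context {X : Type} (op : set X -> Prop) (Htop : is_topology op) (P : set X).

Lemma subspace_topology : is_topology (subspace op P).
Proof.
  split; [|split].
  - exists (fun _ => True). split; [now apply open_full | tauto].
  - intros V W (U1 & H1 & E1) (U2 & H2 & E2). exists (fun x => U1 x /\ U2 x). split.
    + now apply open_inter.
    + intros z. rewrite E1, E2. tauto.
  - intros F HF.
    (* The union of all open sets whose trace belongs to [F] avoids choosing one for each member. *)
    exists (fun x => exists U, (op U /\ exists V, F V /\
                        forall z, V z <-> U (proj1_sig z)) /\ U x).
    split; [apply Htop; tauto|]. intros z. split.
    + intros (V & FV & Vz). destruct (HF V FV) as (U & HU & E). exists U.
      split; [eauto|]. now apply E.
    + intros (U & (_ & V & FV & E) & Uz). exists V. split; [assumption|]. now apply E.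
Qed.

Lemma subspace_hausdorff : hausdorff op -> hausdorff (subspace op P).
Proof.
  intros Hh x y Hxy.
  destruct (Hh (proj1_sig x) (proj1_sig y)) as (U & V & HU & HV & Ux & Vy & HUV).
  { intros E. now apply Hxy, sig_ext. }
  exists (fun z => U (proj1_sig z)), (fun z => V (proj1_sig z)).
  split; [exists U; split; [assumption | tauto]|].
  split; [exists V; split; [assumption | tauto]|].
  split; [assumption|]. split; [assumption|]. intros z. apply HUV.
Qed.

Lemma subspace_compact : Defs.compact op -> closed op P -> Defs.compact (subspace op P).
Proof.
  intros Hc HP F [HF Hcov].
  (* These sets cover [P]; the open complement of [P] completes them to a cover of the space. *)
  set (G := fun U => op U /\
              exists V, F V /\ forall z, V z <-> U (proj1_sig z)).
  destruct (Hc (fun U => G U \/ U = fun x => ~ P x)) as (l & Hl & Hlc).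
  { split.
    - intros U [[HU _] | ->]; assumption.
    - intros x. destruct (classic (P x)) as [Px | nPx].
      + destruct (Hcov (exist _ x Px)) as (V & FV & Vx).
        destruct (HF V FV) as (U & HU & E). exists U. split.
        * left. split; eauto.
        * exact (proj1 (E _) Vx).
      + exists (fun x => ~ P x). auto. }
  assert (Hm : exists m, (forall V, In V m -> F V) /\
             forall U, In U l -> G U -> exists V, In V m /\ forall z, V z <-> U (proj1_sig z)).
  { clear Hlc Hl. induction l as [|U l (m & Hm1 & Hm2)].
    - exists nil. simpl. split; tauto.
    - destruct (classic (G U)) as [GU | nGU].
      + destruct GU as (HU & V & FV & E). exists (V :: m). split.
        * intros W [<- | HW]; auto.
        * intros W [<- | HW] GW.
          -- exists V. simpl. auto.
          -- destruct (Hm2 W HW GW) as (V' & ? & ?). exists V'. simpl. auto.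
      + exists m. split; [assumption|]. intros W [<- | HW] GW; [contradiction | auto]. }
  destruct Hm as (m & Hm1 & Hm2). exists m. split; [assumption|]. intros z.
  destruct (Hlc (proj1_sig z)) as (U & HU & Uz). destruct (Hl U HU) as [GU | ->].
  - destruct (Hm2 U HU GU) as (V & HV & E). exists V. split; [assumption|]. now apply E.
  - destruct Uz. exact (proj2_sig z).
Qed.

Lemma continuous_into_subspace {Y : Type} (opY : set Y -> Prop) (f : Y -> {x | P x}) :
  continuous opY op (fun y => proj1_sig (f y)) -> continuous opY (subspace op P) f.
Proof.
  intros Hf V (U & HU & E). replace (fun y => V (f y)) with (fun y => U (proj1_sig (f y))).
  - now apply Hf.
  - apply set_ext. intros y. symmetry. apply E.
Qed.

Lemma subspace_inclusion_continuous : continuous (subspace op P) op (@proj1_sig X P).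
Proof. intros U HU. exists U. split; [exact HU | tauto]. Qed.

Lemma subset_closure (x : X) : P x -> closure op P x.
Proof. intros Px U _ Ux. eauto. Qed.

Lemma closure_closed : closed op (closure op P).
Proof.
  unfold closed. apply open_of_nbhds; [assumption|]. intros x Hx.
  apply not_all_ex_not in Hx. destruct Hx as (U & HU).
  apply imply_to_and in HU. destruct HU as (HU & HU').
  apply imply_to_and in HU'. destruct HU' as (Ux & HU').
  exists U. repeat split; trivial. intros y Uy Hy. exact (HU' (Hy U HU Uy)).
Qed.

End Subspace.

Lemma continuous_comp {X Y Z : Type} (opX : set X -> Prop) (opY : set Y -> Prop)
  (opZ : set Z -> Prop) (f : X -> Y) (g : Y -> Z) :
  continuous opX opY f -> continuous opY opZ g -> continuous opX opZ (fun x => g (f x)).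
Proof. intros Hf Hg V HV. apply (Hf (fun y => V (g y))). now apply Hg. Qed.

(** * Continuity of multiplication and of translations *)

Section SemigroupNbhds.
Context {X : Type} (op : set X -> Prop) (mul : X -> X -> X)
  (HX : topological_semigroup op mul).

Lemma mul_nbhds (x y : X) (W : set X) :
  op W -> W (mul x y) ->
  exists U V, op U /\ op V /\ U x /\ V y /\ (forall a b, U a -> V b -> W (mul a b)).
Proof. intros HW Wxy. exact (proj2 (proj2 HX) W HW (x, y) Wxy). Qed.

Lemma continuous_mul_l (a : X) : continuous op op (mul a).
Proof.
  apply continuous_of_nbhds; [apply HX|]. intros x V HV Vx.
  destruct (mul_nbhds a x V HV Vx) as (U & W & HU & HW & Ua & Wx & H).
  exists W. auto.
Qed.

Lemma continuous_mul_r (a : X) : continuous op op (fun x => mul x a).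
Proof.
  apply continuous_of_nbhds; [apply HX|]. intros x V HV Vx.
  destruct (mul_nbhds x a V HV Vx) as (U & W & HU & HW & Ua & Wx & H).
  exists U. auto.
Qed.

End SemigroupNbhds.

(** * The bicyclic semigroup inside [S] *)

Section DenseBicyclic.
Context {S : Type} (opS : set S -> Prop) (mul : S -> S -> S) (iota : bicyclic -> S)
  (HS : topological_semigroup opS mul) (Hhaus : hausdorff opS)
  (Hinj : injective iota) (Hhom : semigroup_hom bmul mul iota)
  (Hdense : dense opS (fun s => exists x, iota x = s)).

(** Deleting the points of [l] from [U] one at a time leaves an open set without elements of
    $\mathcal C(p,q)$, which is empty by density. *)
Lemma open_meeting_bicyclic_finitely (l : list bicyclic) (U : set S) :
  opS U -> (forall c, U (iota c) -> In c l) ->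
  forall x, U x -> exists c, In c l /\ x = iota c.
Proof.
  revert U. induction l as [|a l IH]; intros U HU Hl x Ux.
  - destruct (Hdense U HU (ex_intro _ x Ux)) as (y & Uy & c & <-).
    destruct (Hl c Uy).
  - destruct (classic (x = iota a)) as [-> | Hx].
    + exists a. simpl. auto.
    + destruct (IH (fun x => U x /\ x <> iota a)) with (x := x) as (c & Hc & ->).
      * apply open_inter; [apply HS | assumption |].
        apply open_neq_point; [apply HS | assumption].
      * intros c [Uc Hc]. destruct (Hl c Uc) as [-> | ?]; [now destruct Hc | assumption].
      * now split.
      * exists c. simpl. auto.
Qed.

Lemma isolated_of_open_finite (l : list bicyclic) (U : set S) (c : bicyclic) :
  opS U -> (forall c, U (iota c) -> In c l) -> U (iota c) ->
  opS (fun x => x = iota c).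
Proof.
  intros HU Hl Uc.
  replace (fun x => x = iota c)
    with (fun x => U x /\ forall y, In y (map iota l) -> y <> iota c -> x <> y).
  - apply open_inter; [apply HS | assumption |].
    apply open_not_in with (P := fun y => y <> iota c); [apply HS | assumption].
  - apply set_ext. intros x. split.
    + intros [Ux Hx].
      destruct (open_meeting_bicyclic_finitely l U HU Hl x Ux) as (d & Hd & ->).
      apply NNPP. intros Hdc. now apply (Hx (iota d)); [apply in_map | |].
    + intros ->. split; [assumption|]. auto.
Qed.

Lemma in_rectangle (n m a b : nat) :
  n <= a -> m <= b -> In (n, m) (list_prod (seq 0 (1 + a)) (seq 0 (1 + b))).
Proof. intros Hn Hm. apply in_prod; apply in_seq; lia. Qed.

(* [p^n q^m] with [n >= 1] is fixed by left multiplication by the idempotent [p q], and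
   with [m >= 1] by right multiplication, so [1] is the only element fixed by neither. *)
Lemma identity_isolated : opS (fun x => x = iota (0, 0)).
Proof.
  apply isolated_of_open_finite with (l := (0, 0) :: nil)
    (U := fun x => mul (iota (1, 1)) x <> x /\ mul x (iota (1, 1)) <> x).
  - apply open_inter; [apply HS | |].
    + apply (open_neq opS (proj1 HS) opS (mul (iota (1, 1))) (fun x => x)); trivial.
      * now apply continuous_mul_l.
      * now intros V HV.
    + apply (open_neq opS (proj1 HS) opS (fun x => mul x (iota (1, 1))) (fun x => x)); trivial.
      * now apply continuous_mul_r.
      * now intros V HV.
  - intros [n m] [H1 H2]. left. rewrite <- Hhom in H1, H2. unfold bmul in H1, H2.
    simpl fst in *; simpl snd in *. destruct n as [|n].
    + destruct m as [|m]; [reflexivity|]. destruct H2. f_equal. f_equal; lia.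
    + destruct H1. f_equal. f_equal; lia.
  - rewrite <- !Hhom. unfold bmul; simpl.
    split; intros E; apply Hinj in E; discriminate.
Qed.

(** Since $q^a p^a q^b p^b = 1$, the point $p^a q^b$ lies in the preimage of the isolated point $1$
    under $x \mapsto q^a x p^b$. In $\mathcal C(p,q)$ the equation $q^a p^n q^m p^b = 1$ forces $n
    \le a$ and $m \le b$. *)
Lemma bicyclic_isolated (c : bicyclic) : opS (fun x => x = iota c).
Proof.
  destruct c as [a b].
  apply isolated_of_open_finite
    with (l := list_prod (seq 0 (1 + a)) (seq 0 (1 + b)))
      (U := fun x => mul (mul (iota (0, a)) x) (iota (b, 0)) = iota (0, 0)).
  - apply (continuous_comp opS opS opS (mul (iota (0, a))) (fun x => mul x (iota (b, 0))))
      with (V := fun x => x = iota (0, 0)).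
    + now apply continuous_mul_l.
    + now apply continuous_mul_r.
    + apply identity_isolated.
  - intros [n m] E. rewrite <- !Hhom in E. apply Hinj in E. unfold bmul in E.
    simpl fst in E; simpl snd in E. injection E as E1 E2. apply in_rectangle; lia.
  - rewrite <- !Hhom. f_equal. unfold bmul; simpl. f_equal; lia.
Qed.

Lemma open_in_bicyclic (P : set S) : (forall x, P x -> exists c, iota c = x) -> opS P.
Proof.
  intros HP. apply open_of_nbhds; [apply HS|]. intros x Px.
  destruct (HP x Px) as (c & <-). exists (fun x => x = iota c).
  split; [apply bicyclic_isolated|]. split; [reflexivity|]. now intros y ->.
Qed.

(* A neighbourhood of a point outside [C(p,q)] contains infinitely many elements of
   [C(p,q)], whereas [a x = c] and [x a = c] have finitely many solutions in [C(p,q)]. *)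
Lemma right_factor_bicyclic (s t : S) (c : bicyclic) :
  mul s t = iota c -> exists d, iota d = t.
Proof.
  intros E.
  destruct (mul_nbhds opS mul HS s t _ (bicyclic_isolated c) E)
    as (U & V & HU & HV & Us & Vt & HUV).
  (* Near [s] there is some $p^a q^b$. If $p^n q^m$ lies in [V], then $p^a q^b p^n q^m = c$, which
     bounds $n$ by [b + fst c] and $m$ by [snd c]. *)
  destruct (Hdense U HU (ex_intro _ s Us)) as (s' & Us' & [a b] & <-).
  destruct (open_meeting_bicyclic_finitely
              (list_prod (seq 0 (1 + (b + fst c))) (seq 0 (1 + snd c))) V HV)
    with (x := t) as (d & _ & ->); [|assumption | now exists d].
  intros [n m] Vd. specialize (HUV _ _ Us' Vd). rewrite <- Hhom in HUV.
  apply Hinj in HUV. subst c. unfold bmul. apply in_rectangle; simpl; lia.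
Qed.

Lemma left_factor_bicyclic (s t : S) (c : bicyclic) :
  mul s t = iota c -> exists d, iota d = s.
Proof.
  intros E.
  destruct (mul_nbhds opS mul HS s t _ (bicyclic_isolated c) E)
    as (U & V & HU & HV & Us & Vt & HUV).
  destruct (Hdense V HV (ex_intro _ t Vt)) as (t' & Vt' & [a b] & <-).
  destruct (open_meeting_bicyclic_finitely
              (list_prod (seq 0 (1 + fst c)) (seq 0 (1 + (a + snd c)))) U HU)
    with (x := s) as (d & _ & ->); [|assumption | now exists d].
  intros [n m] Ud. specialize (HUV _ _ Ud Vt'). rewrite <- Hhom in HUV.
  apply Hinj in HUV. subst c. unfold bmul. apply in_rectangle; simpl; lia.
Qed.

(** * The sets $D_c$ and the square of $S$ *)

Definition fiber (c : bicyclic) : set (S * S) :=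
  fun z => exists x y, bmul x y = c /\ z = (iota x, iota y).

(** Both factors of a product in $\mathcal C(p,q)$ lie in $\mathcal C(p,q)$. So $D_c$ is the full
    preimage of a closed point under multiplication, which makes it closed. *)
Lemma fiber_mul (c : bicyclic) (z : S * S) :
  fiber c z <-> mul (fst z) (snd z) = iota c.
Proof.
  split.
  - intros (x & y & <- & ->). simpl. now rewrite Hhom.
  - destruct z as [s t]; simpl. intros E.
    destruct (left_factor_bicyclic s t c E) as (x & <-).
    destruct (right_factor_bicyclic (iota x) t c E) as (y & <-).
    exists x, y. split; [|reflexivity]. apply Hinj. now rewrite Hhom.
Qed.

Lemma pair_isolated (x y : bicyclic) : prod_topology opS opS (fun z => z = (iota x, iota y)).
Proof.
  intros z ->. exists (fun s => s = iota x), (fun s => s = iota y).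
  repeat split; trivial; try apply bicyclic_isolated. now intros a b -> ->.
Qed.

Lemma fiber_open (c : bicyclic) : prod_topology opS opS (fiber c).
Proof.
  intros z (x & y & E & ->). exists (fun s => s = iota x), (fun s => s = iota y).
  repeat split; trivial; try apply bicyclic_isolated. intros a b -> ->. now exists x, y.
Qed.

Lemma fiber_closed (c : bicyclic) : closed (prod_topology opS opS) (fiber c).
Proof.
  intros z Hz. rewrite fiber_mul in Hz.
  destruct (mul_nbhds opS mul HS (fst z) (snd z) (fun x => x <> iota c))
    as (U & V & HU & HV & Ux & Vy & H); trivial.
  { apply open_neq_point; [apply HS | assumption]. }
  exists U, V. repeat split; trivial. intros a b Ua Vb. rewrite fiber_mul. now apply H.
Qed.

Lemma fiber_discrete (c : bicyclic) :
  discrete_subspace (prod_topology opS opS) (fiber c).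
Proof.
  intros z (x & y & E & ->). exists (fun z => z = (iota x, iota y)).
  split; [apply pair_isolated|]. now split.
Qed.

Lemma square_not_pseudocompact : ~ pseudocompact (prod_topology opS opS).
Proof.
  intros Hps.
  (* The singletons of $D_1$ and the complement of $D_1$ are disjoint open sets, so this cover is
     locally finite. *)
  set (F := fun U : set (S * S) => U = (fun z => ~ fiber (0, 0) z) \/
              exists w, fiber (0, 0) w /\ U = fun z => z = w).
  destruct (Hps F) as (l & Hl).
  - split.
    + intros U [-> | (w & (x & y & E & ->) & ->)].
      * apply fiber_closed.
      * apply pair_isolated.
    + intros z. destruct (classic (fiber (0, 0) z)) as [Hz | Hz].
      * exists (fun w => w = z). split; [right; eauto | reflexivity].
      * exists (fun z => ~ fiber (0, 0) z). split; [now left | assumption].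
  - intros z. destruct (classic (fiber (0, 0) z)) as [Hz | Hz].
    + exists (fun w => w = z). split; [|split; [reflexivity|]].
      * destruct Hz as (x & y & E & ->). apply pair_isolated.
      * exists ((fun w => w = z) :: nil). intros U (FU & y & -> & Uz).
        destruct FU as [-> | (w & Hw & ->)]; [contradiction|]. subst w. now left.
    + exists (fun z => ~ fiber (0, 0) z). split; [apply fiber_closed|].
      split; [assumption|].
      exists ((fun z => ~ fiber (0, 0) z) :: nil). intros U (FU & y & Hy & Uy).
      destruct FU as [-> | (w & Hw & ->)]; [now left|]. subst w. contradiction.
  (* The singletons of $(q^n, p^n)$ are distinct members of [F], so [1 + length l] of them cannot
     all occur in [l]. *)
  - set (sing := fun n (z : S * S) => z = (iota (0, n), iota (n, 0))).
    assert (Hinc : incl (map sing (seq 0 (1 + length l))) l).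
    { intros U HU. apply in_map_iff in HU. destruct HU as (n & <- & _). apply Hl. right.
      exists (iota (0, n), iota (n, 0)). split; [|reflexivity].
      exists (0, n), (n, 0). split; [|reflexivity]. unfold bmul; simpl. f_equal; lia. }
    apply NoDup_incl_length in Hinc.
    + rewrite length_map, length_seq in Hinc. exact (PeanoNat.Nat.nle_succ_diag_l _ Hinc).
    + apply FinFun.Injective_map_NoDup; [|apply seq_NoDup].
      intros n m E. assert (H : sing m (iota (0, n), iota (n, 0))) by (rewrite <- E; reflexivity).
      injection H as H _. apply Hinj in H. now injection H.
Qed.

End DenseBicyclic.

(** * Almost periodic compactification *)

Section CompactQuotient.
Context {A : Type} (opA : set A -> Prop) (mul : A -> A -> A) (h : bicyclic -> A)
  (HA : topological_semigroup opA mul) (Hc : Defs.compact opA) (Hh : hausdorff opA)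
  (Hhom : semigroup_hom bmul mul h) (Hd : dense opA (fun a => exists c, h c = a)).

Lemma image_identity (x : A) : mul (h (0, 0)) x = x /\ mul x (h (0, 0)) = x.
Proof.
  split; apply NNPP; intros Hx.
  - destruct (Hd (fun x => mul (h (0, 0)) x <> x)) as (y & Hy & [n m] & <-).
    + apply (open_neq opA (proj1 HA) opA (mul (h (0, 0))) (fun x => x)); trivial.
      * now apply continuous_mul_l.
      * now intros V HV.
    + now exists x.
    + apply Hy. rewrite <- Hhom. f_equal. unfold bmul; simpl. f_equal; lia.
  - destruct (Hd (fun x => mul x (h (0, 0)) <> x)) as (y & Hy & [n m] & <-).
    + apply (open_neq opA (proj1 HA) opA (fun x => mul x (h (0, 0))) (fun x => x)); trivial.
      * now apply continuous_mul_r.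
      * now intros V HV.
    + now exists x.
    + apply Hy. rewrite <- Hhom. f_equal. unfold bmul; simpl. f_equal; lia.
Qed.

(* If [(x, y)] is a cluster point of the pairs [(h (p^n), h (q^n))] then [y x = 1], so
   [q^n p^m = p^(m-n)] comes close to [1] for suitable [n < m]. *)
Lemma powers_recur (W : set A) :
  opA W -> W (h (0, 0)) -> exists k, W (h (1 + k, 0)).
Proof.
  intros HW We.
  destruct (compact_sequence_cluster opA (fun n => h (n, 0)) Hc) as (x & Hx).
  (* The tails are refined by the conditions that $h(p^n)$ be near [x]. A cluster point [y] of
     $h(q^n)$ along them makes $(x, y)$ a joint cluster point. *)
  destruct (compact_cluster_point opA
              (fun M => exists N U, opA U /\ U x /\
                 forall n, N <= n -> U (h (n, 0)) -> M n) (fun n => h (0, n)) Hc)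
    as (y & Hy).
  - exists 0, (fun _ => True). repeat split; trivial. apply open_full, HA.
  - intros M M' (N & U & HU & Ux & HM) (N' & U' & HU' & Ux' & HM').
    exists (fun n => M n /\ M' n). split; [|auto].
    exists (N + N'), (fun a => U a /\ U' a).
    split; [now apply open_inter; [apply HA | |]|]. split; [now split|].
    intros n Hn [H1 H2]. split; [apply HM | apply HM']; trivial; lia.
  - intros M (N & U & HU & Ux & HM). destruct (Hx U HU Ux N) as (n & Hn & Un).
    exists n. auto.
  - assert (Hyx : mul y x = h (0, 0)).
    { apply NNPP. intros Hne.
      destruct (mul_nbhds opA mul HA y x (fun a => a <> h (0, 0)))
        as (V & U & HV & HU & Vy & Ux & H); trivial.
      { apply open_neq_point; [apply HA | assumption]. }
      destruct (Hy V (fun n => U (h (n, 0))) HV Vy) as (n & Un & Vn).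
      { exists 0, U. auto. }
      apply (H _ _ Vn Un). rewrite <- Hhom. f_equal. unfold bmul; simpl. f_equal; lia. }
    destruct (mul_nbhds opA mul HA y x W) as (V & U & HV & HU & Vy & Ux & H); trivial.
    { now rewrite Hyx. }
    destruct (Hy V (fun _ => True) HV Vy) as (n & _ & Vn).
    { exists 0, U. auto. }
    destruct (Hx U HU Ux (1 + n)) as (m & Hm & Um).
    exists (m - n - 1). specialize (H _ _ Vn Um). rewrite <- Hhom in H.
    replace (1 + (m - n - 1), 0) with (bmul (0, n) (m, 0)); [assumption|].
    unfold bmul; simpl fst; simpl snd. f_equal; lia.
Qed.

Lemma image_idempotent : h (1, 1) = h (0, 0).
Proof.
  (* The preimages of neighbourhoods of $1$ under $z \mapsto h(p) z$ are nonempty because the powers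
     of $h(p)$ recur to $1$. A cluster point satisfies $h(p) z = 1$, and multiplying by $h(q)$ on
     the left gives $z = h(q)$. *)
  destruct (compact_cluster_point opA
              (fun M => exists W, opA W /\ W (h (0, 0)) /\
                 forall z, W (mul (h (1, 0)) z) -> M z) (fun z => z) Hc)
    as (z & Hz).
  - exists (fun _ => True). repeat split; trivial. apply open_full, HA.
  - intros M M' (U & HU & Ue & HM) (U' & HU' & Ue' & HM').
    exists (fun n => M n /\ M' n). split; [|auto].
    exists (fun a => U a /\ U' a).
    split; [now apply open_inter; [apply HA | |]|]. split; [now split|].
    intros z [H1 H2]. auto.
  - intros M (W & HW & We & HM). destruct (powers_recur W HW We) as (k & Wk).
    exists (h (k, 0)). apply HM. rewrite <- Hhom.
    replace (bmul (1, 0) (k, 0)) with (1 + k, 0); [assumption|].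
    unfold bmul; simpl fst; simpl snd. f_equal; lia.
  - assert (Haz : mul (h (1, 0)) z = h (0, 0)).
    { apply NNPP. intros Hne.
      destruct (Hh _ _ Hne) as (V & W & HV & HW & Vz & We & HVW).
      destruct (Hz (fun z => V (mul (h (1, 0)) z)) (fun z => W (mul (h (1, 0)) z)))
        as (y & Wy & Vy); trivial.
      - now apply (continuous_mul_l opA mul HA (h (1, 0))).
      - now exists W.
      - apply (HVW (mul (h (1, 0)) y)). now split. }
    assert (Hzb : z = h (0, 1)).
    { transitivity (mul (mul (h (0, 1)) (h (1, 0))) z).
      - rewrite <- Hhom. symmetry. apply image_identity.
      - rewrite (proj1 (proj2 HA)), Haz. apply image_identity. }
    rewrite <- Haz, Hzb, <- Hhom. reflexivity.
Qed.

(** Each increment of [k] inserts a factor $pq$ between $p^{i+k}$ and $q^{j+k}$, and [h] sends it to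
    the identity. *)
Lemma image_shift (k i j : nat) : h (i + k, j + k) = h (i, j).
Proof.
  induction k as [|k IH].
  - f_equal. f_equal; lia.
  - rewrite <- IH. transitivity (mul (mul (h (i + k, 0)) (h (1, 1))) (h (0, j + k))).
    + rewrite <- !Hhom. f_equal. unfold bmul; simpl. f_equal; lia.
    + rewrite image_idempotent, <- !Hhom. f_equal. unfold bmul; simpl. f_equal; lia.
Qed.

(** Thus [h] factors through $p^i q^j \mapsto i - j$ into the integers; sums replace the truncated
    subtraction of [nat]. *)
Lemma image_difference (i j i' j' : nat) : i + j' = i' + j -> h (i, j) = h (i', j').
Proof.
  intros H. destruct (Nat.le_ge_cases i i') as [Hi | Hi].
  - rewrite <- (image_shift (i' - i) i j). f_equal. f_equal; lia.
  - rewrite <- (image_shift (i - i') i' j'). f_equal. f_equal; lia.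
Qed.

Lemma image_commutative (x y : A) : mul x y = mul y x.
Proof.
  apply NNPP. intros Hne.
  destruct (Hh _ _ Hne) as (P & Q & HP & HQ & Pxy & Qyx & HPQ).
  destruct (mul_nbhds opA mul HA x y P HP Pxy) as (U & V & HU & HV & Ux & Vy & H).
  destruct (mul_nbhds opA mul HA y x Q HQ Qyx) as (V' & U' & HV' & HU' & Vy' & Ux' & H').
  destruct (Hd (fun a => U a /\ U' a)) as (a & [Ua Ua'] & [n m] & <-).
  { now apply open_inter; [apply HA | |]. }
  { exists x. now split. }
  destruct (Hd (fun a => V a /\ V' a)) as (b & [Vb Vb'] & [k l] & <-).
  { now apply open_inter; [apply HA | |]. }
  { exists y. now split. }
  apply (HPQ (mul (h (n, m)) (h (k, l)))). split; [now apply H|].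
  replace (mul (h (n, m)) (h (k, l))) with (mul (h (k, l)) (h (n, m))); [now apply H'|].
  rewrite <- !Hhom. apply image_difference; simpl; lia.
Qed.

(** A cluster point of the second entries, along pairs whose first entry approaches [x], is inverse
    to [x]. Taking all inverse pairs for [M] yields existence of inverses; taking those whose second
    entry avoids a given open set yields continuity of inversion. *)
Lemma inverse_cluster (x : A) (M : A -> A -> Prop) :
  (forall x' y, M x' y -> mul x' y = h (0, 0)) ->
  (forall U, opA U -> U x -> exists x' y, U x' /\ M x' y) ->
  exists y, mul x y = h (0, 0) /\
    forall V, opA V -> V y -> exists x' y', M x' y' /\ V y'.
Proof.
  intros HM Hx.
  destruct (compact_cluster_point opA
              (fun N => exists U, opA U /\ U x /\
                 forall z, U (fst z) -> M (fst z) (snd z) -> N z)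
              (fun z : A * A => snd z) Hc) as (y & Hy).
  - exists (fun _ => True). repeat split; trivial. apply open_full, HA.
  - intros N N' (U & HU & Ux & HN) (U' & HU' & Ux' & HN').
    exists (fun n => N n /\ N' n). split; [|auto].
    exists (fun a => U a /\ U' a).
    split; [now apply open_inter; [apply HA | |]|]. split; [now split|].
    intros z [H1 H2] Hz. auto.
  - intros N (U & HU & Ux & HN). destruct (Hx U HU Ux) as (x' & y & Ux' & Hy).
    exists (x', y). now apply HN.
  - assert (Hnear : forall U V, opA U -> U x -> opA V -> V y ->
              exists x' y', U x' /\ V y' /\ M x' y').
    { intros U V HU Ux HV Vy.
      destruct (Hy V (fun z => U (fst z) /\ M (fst z) (snd z)) HV Vy)
        as ([x' y'] & [Ux' Hxy'] & Vy').
      - exists U. auto.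
      - now exists x', y'. }
    exists y. split.
    + apply NNPP. intros Hne.
      destruct (mul_nbhds opA mul HA x y (fun a => a <> h (0, 0)))
        as (U & V & HU & HV & Ux & Vy & H); trivial.
      { apply open_neq_point; [apply HA | assumption]. }
      destruct (Hnear U V HU Ux HV Vy) as (x' & y' & Ux' & Vy' & Hxy').
      exact (H x' y' Ux' Vy' (HM _ _ Hxy')).
    + intros V HV Vy.
      destruct (Hnear (fun _ => True) V) as (x' & y' & _ & Vy' & Hxy'); trivial.
      { apply open_full, HA. }
      now exists x', y'.
Qed.

Lemma inverse_exists (x : A) : exists y, mul x y = h (0, 0).
Proof.
  destruct (inverse_cluster x (fun x' y => mul x' y = h (0, 0))) as (y & Hy & _).
  - trivial.
  - intros U HU Ux. destruct (Hd U HU (ex_intro _ x Ux)) as (x' & Ux' & [n m] & <-).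
    exists (h (n, m)), (h (m, n)). split; [assumption|].
    rewrite <- Hhom. apply image_difference; simpl; lia.
  - now exists y.
Qed.

Lemma inverse_unique (x y z : A) : mul x y = h (0, 0) -> mul x z = h (0, 0) -> y = z.
Proof.
  intros Hy Hz. rewrite <- (proj1 (image_identity z)), <- Hy.
  rewrite (image_commutative x y), (proj1 (proj2 HA)), Hz.
  symmetry. apply image_identity.
Qed.

Lemma image_group : compact_abelian_topological_group opA mul.
Proof.
  split; [assumption|]. split; [assumption|]. split; [apply image_commutative|].
  set (inv := fun x => proj1_sig (constructive_indefinite_description _ (inverse_exists x))).
  assert (Hinv : forall x, mul x (inv x) = h (0, 0)).
  { intros x. unfold inv. apply proj2_sig. }
  exists (h (0, 0)), inv. split; [apply image_identity|]. split.
  { intros x. split; [rewrite image_commutative|]; apply Hinv. }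
  (* If inversion were discontinuous at [x], inverses outside [V] would cluster at an inverse of
     [x]. By uniqueness this is [inv x], which lies in the open set [V]. *)
  apply continuous_of_nbhds; [apply HA|]. intros x V HV Vx. apply NNPP. intros Hno.
  destruct (inverse_cluster x (fun x' y => y = inv x' /\ ~ V y)) as (y & Hy & HyV).
  - intros x' y [-> _]. apply Hinv.
  - intros U HU Ux. apply NNPP. intros HU'. apply Hno. exists U.
    repeat split; trivial. intros x' Ux'. apply NNPP. intros Hx'. apply HU'.
    exists x', (inv x'). auto.
  - destruct (HyV V HV) as (x' & y' & [_ Hy'] & Vy'); [|contradiction].
    now rewrite (inverse_unique x y (inv x) Hy (Hinv x)).
Qed.

End CompactQuotient.

Lemma closure_mul_closed {A : Type} (opA : set A -> Prop) (mul : A -> A -> A) (E : set A) :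
  topological_semigroup opA mul -> (forall x y, E x -> E y -> E (mul x y)) ->
  forall x y, closure opA E x -> closure opA E y -> closure opA E (mul x y).
Proof.
  intros HA HE x y Hx Hy W HW Wxy.
  destruct (mul_nbhds opA mul HA x y W HW Wxy) as (U & V & HU & HV & Ux & Vy & H).
  destruct (Hx U HU Ux) as (a & Ua & Ea). destruct (Hy V HV Vy) as (b & Vb & Eb).
  exists (mul a b). auto.
Qed.

(* The closure of [eta S] is again a compact semigroup through which [eta] factors, so by
   uniqueness the identity of [AP(S)] factors through it. *)
Lemma ap_dense {X : Type} (opX : set X -> Prop) (mulX : X -> X -> X)
  (A : Type) (opA : set A -> Prop) (mulA : A -> A -> A) (eta : X -> A) :
  ap_compactification opX mulX A opA mulA eta ->
  dense opA (fun a => exists x, eta x = a).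
Proof.
  intros (HA & Hc & Hh & Hcont & Hhom & Huniv).
  set (E := fun a => exists x, eta x = a).
  assert (HE : forall x, closure opA E (eta x)).
  { intros x. apply subset_closure. now exists x. }
  assert (Hm : forall x y, closure opA E x -> closure opA E y -> closure opA E (mulA x y)).
  { apply closure_mul_closed; [assumption|]. intros a b (x & <-) (y & <-).
    exists (mulX x y). apply Hhom. }
  destruct (Huniv {a | closure opA E a} (subspace opA (closure opA E))
    (fun x y => exist _ (mulA (proj1_sig x) (proj1_sig y))
                  (Hm _ _ (proj2_sig x) (proj2_sig y)))
    (fun x => exist _ (eta x) (HE x))) as (g & Hg & Hghom & Hgeta & _).
  - split; [|split].
    + apply subspace_topology, HA.
    + intros x y z. apply sig_ext, HA.
    + apply continuous_into_subspace. intros W HW z Wz.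
      destruct (mul_nbhds opA mulA HA _ _ W HW Wz) as (U & V & HU & HV & Ux & Vy & H).
      exists (fun x => U (proj1_sig x)), (fun x => V (proj1_sig x)).
      split; [now apply subspace_inclusion_continuous|].
      split; [now apply subspace_inclusion_continuous|].
      split; [assumption|]. split; [assumption|]. intros a b. apply H.
  - apply subspace_compact; [assumption |]. apply closure_closed, HA.
  - now apply subspace_hausdorff.
  - now apply continuous_into_subspace.
  - intros x y. apply sig_ext, Hhom.
  - destruct (Huniv A opA mulA eta) as (k & _ & _ & _ & Hk); trivial.
    intros U HU (a & Ua).
    assert (Ha : closure opA E a); [|exact (Ha U HU Ua)].
    replace a with (proj1_sig (g a)); [apply proj2_sig|].
    transitivity (k a); [|symmetry].
    + apply (Hk (fun a => proj1_sig (g a))).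
      * apply (continuous_comp _ _ _ g _ Hg), subspace_inclusion_continuous.
      * intros x y. now rewrite Hghom.
      * intros x. now rewrite Hgeta.
    + apply (Hk (fun a => a)); trivial.
      * now intros V HV.
      * now intros x y.
Qed.

Lemma ap_group {S : Type} (opS : set S -> Prop) (mul : S -> S -> S)
  (iota : bicyclic -> S) (A : Type) (opA : set A -> Prop) (mulA : A -> A -> A)
  (eta : S -> A) :
  injective iota -> semigroup_hom bmul mul iota ->
  dense opS (fun s => exists x, iota x = s) ->
  ap_compactification opS mul A opA mulA eta ->
  compact_abelian_topological_group opA mulA /\ ~ injective eta.
Proof.
  intros Hinj Hhom Hd Hap. pose proof (ap_dense _ _ _ _ _ _ Hap) as Hdeta.
  destruct Hap as (HA & Hc & Hh & Hcont & Hhometa & _).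
  assert (Hhom' : semigroup_hom bmul mulA (fun c => eta (iota c))).
  { intros x y. now rewrite Hhom, Hhometa. }
  assert (Hd' : dense opA (fun a => exists c, eta (iota c) = a)).
  { intros U HU HUne. destruct (Hdeta U HU HUne) as (a & Ua & s & <-).
    destruct (Hd (fun s => U (eta s))) as (s' & Us' & c & <-); [now apply Hcont | now exists s |].
    exists (eta (iota c)). eauto. }
  split.
  - now apply image_group with (h := fun c => eta (iota c)).
  - intros Heta. assert (E : iota (1, 1) = iota (0, 0)).
    { apply Heta. now apply (image_idempotent opA mulA (fun c => eta (iota c))). }
    apply Hinj in E. discriminate.
Qed.

(** * The unit interval and the one-point compactification of the integers *)

Lemma R_topology_is_topology : is_topology R_topology.
Proof.
  split; [|split].
  - intros x _. exists 1%R. split; [lra | trivial].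
  - intros U V HU HV x [Ux Vx].
    destruct (HU x Ux) as (a & Ha & HUa). destruct (HV x Vx) as (b & Hb & HVb).
    exists (Rmin a b). split; [now apply Rmin_glb_lt|].
    pose proof (Rmin_l a b). pose proof (Rmin_r a b).
    intros y Hy. split; [apply HUa | apply HVb]; lra.
  - intros F HF x (U & FU & Ux). destruct (HF U FU x Ux) as (a & Ha & HUa).
    exists a. split; [assumption|]. intros y Hy. exists U. auto.
Qed.

Lemma R_topology_lt (a : R) : R_topology (fun x => (x < a)%R).
Proof.
  intros x Hx. exists (a - x)%R. split; [lra|]. intros y Hy.
  apply Rabs_def2 in Hy. lra.
Qed.

Lemma R_topology_gt (a : R) : R_topology (fun x => (a < x)%R).
Proof.
  intros x Hx. exists (x - a)%R. split; [lra|]. intros y Hy.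
  apply Rabs_def2 in Hy. lra.
Qed.

Lemma R_topology_hausdorff : hausdorff R_topology.
Proof.
  intros x y Hxy. destruct (Rdichotomy x y Hxy) as [H | H].
  - exists (fun z => (z < (x + y) / 2)%R), (fun z => ((x + y) / 2 < z)%R).
    split; [apply R_topology_lt|]. split; [apply R_topology_gt|].
    split; [lra|]. split; [lra|]. intros z. lra.
  - exists (fun z => ((x + y) / 2 < z)%R), (fun z => (z < (x + y) / 2)%R).
    split; [apply R_topology_gt|]. split; [apply R_topology_lt|].
    split; [lra|]. split; [lra|]. intros z. lra.
Qed.

Definition unit_interval : set R := fun r => (0 <= r <= 1)%R.

Lemma unit_interval_compact : Defs.compact (subspace R_topology unit_interval).
Proof.
  intros F [HF Hcov].
  (* The supremum [m] of those [x] for which $[0, x]$ is finitely covered will turn out to be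
     $1$. *)
  set (E := fun x => (0 <= x <= 1)%R /\ exists l, (forall U, In U l -> F U) /\
              forall z : sig unit_interval, (proj1_sig z <= x)%R -> exists U, In U l /\ U z).
  assert (H01 : unit_interval 0%R) by (unfold unit_interval; lra).
  assert (E0 : E 0%R).
  { split; [lra|]. destruct (Hcov (exist _ 0%R H01)) as (U & FU & U0).
    exists (U :: nil). split; [now intros V [<- | []]|]. intros [z Hz] Hz0. simpl in Hz0.
    exists U. split; [now left|].
    replace (exist unit_interval z Hz) with (exist unit_interval 0%R H01); [assumption|].
    apply sig_ext. simpl. unfold unit_interval in Hz. lra. }
  destruct (completeness E) as (m & Hub & Hlub).
  { exists 1%R. intros x [Hx _]. lra. }
  { now exists 0%R. }
  assert (Hm : unit_interval m).
  { split; [now apply Hub|]. apply Hlub. intros x [Hx _]. lra. }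
  destruct (Hcov (exist _ m Hm)) as (U & FU & Um).
  destruct (HF U FU) as (U' & HU' & HUU'). apply HUU' in Um. simpl in Um.
  destruct (HU' m Um) as (eps & Heps & Hball).
  assert (Hx : exists x, E x /\ (m - eps < x)%R).
  { apply NNPP. intros Hno. assert (m <= m - eps)%R; [|lra]. apply Hlub.
    intros x Ex. apply Rnot_lt_le. intros Hx. apply Hno. eauto. }
  destruct Hx as (x & (Hx & l & Hl & Hlx) & Hxm).
  (* The set [U] around [m] extends a finite cover past [m], up to $1$ at most. As [m] bounds [E],
     the minimum must be $1$. *)
  assert (Em : E (Rmin 1 (m + eps / 2))).
  { unfold unit_interval in Hm. split.
    - split; [apply Rmin_glb; lra | apply Rmin_l].
    - exists (U :: l). split; [intros V [<- | HV]; auto|]. intros z Hz.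
      destruct (Rle_or_lt (proj1_sig z) x) as [Hzx | Hzx].
      + destruct (Hlx z Hzx) as (V & HV & Vz). exists V. split; [now right | assumption].
      + exists U. split; [now left|]. apply HUU', Hball.
        pose proof (Rmin_r 1 (m + eps / 2)). destruct z as [z Hz']. simpl in *.
        apply Rabs_def1; lra. }
  pose proof (Hub _ Em) as Hle. destruct Em as (_ & l' & Hl' & Hcov').
  exists l'. split; [assumption|]. intros z. apply Hcov'.
  destruct z as [z Hz]; simpl. unfold unit_interval in Hz.
  apply Rmin_glb; [lra|]. unfold Rmin in Hle. destruct Rle_dec; lra.
Qed.

(** The functions given by [tychonoff] are real-valued; truncation gives them the compact target
    required to extend them to $\beta S$. *)
Definition clamp (r : R) : sig unit_interval :=
  exist unit_interval (Rmax 0 (Rmin 1 r))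
    (conj (Rmax_l _ _) (Rmax_lub _ _ _ Rle_0_1 (Rmin_l _ _))).

Lemma clamp_continuous : continuous R_topology (subspace R_topology unit_interval) clamp.
Proof.
  apply continuous_into_subspace. intros V HV x Vx.
  destruct (HV _ Vx) as (eps & Heps & H). exists eps. split; [assumption|].
  intros y Hy. apply H. apply Rle_lt_trans with (2 := Hy). simpl.
  unfold Rmax, Rmin. repeat destruct Rle_dec; unfold Rabs; repeat destruct Rcase_abs; lra.
Qed.

Definition one_point (V : set (option nat)) : Prop :=
  V None -> exists N, forall n, N <= n -> V (Some n).

Lemma one_point_topology : is_topology one_point.
Proof.
  split; [|split].
  - intros _. now exists 0.
  - intros U V HU HV [HU0 HV0]. destruct (HU HU0) as (N & HN). destruct (HV HV0) as (M & HM).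
    exists (N + M). intros n Hn. split; [apply HN | apply HM]; lia.
  - intros F HF (U & FU & U0). destruct (HF U FU U0) as (N & HN). exists N. eauto.
Qed.

Lemma one_point_compact : Defs.compact one_point.
Proof.
  intros F [HF Hcov]. destruct (Hcov None) as (U & FU & U0).
  destruct (HF U FU U0) as (N & HN).
  assert (Hl : exists l, (forall V, In V l -> F V) /\
             forall n, n < N -> exists V, In V l /\ V (Some n)).
  { clear HN. induction N as [|N (l & Hl & HlN)].
    - exists nil. split; [intros V [] | lia].
    - destruct (Hcov (Some N)) as (V & FV & VN). exists (V :: l). split.
      + intros W [<- | HW]; auto.
      + intros n Hn. destruct (Nat.eq_dec n N) as [-> | Hne].
        * exists V. split; [now left | assumption].
        * destruct (HlN n) as (W & HW & Wn); [lia|]. exists W. split; [now right | assumption]. }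
  destruct Hl as (l & Hl & HlN). exists (U :: l). split; [intros V [<- | HV]; auto|].
  intros [n|].
  - destruct (Nat.lt_ge_cases n N) as [Hn | Hn].
    + destruct (HlN n Hn) as (V & HV & Vn). exists V. split; [now right | assumption].
    + exists U. split; [now left | now apply HN].
  - exists U. split; [now left | assumption].
Qed.

Lemma one_point_isolated (n : nat) : one_point (fun o => o = Some n).
Proof. discriminate. Qed.

Lemma one_point_hausdorff : hausdorff one_point.
Proof.
  assert (Hco : forall n, one_point (fun o => o <> Some n)).
  { intros n _. exists (1 + n). intros m Hm [= ->]. lia. }
  intros [n|] y Hy.
  - exists (fun o => o = Some n), (fun o => o <> Some n).
    split; [apply one_point_isolated|]. split; [apply Hco|].
    split; [reflexivity|]. split; [congruence|]. tauto.
  - destruct y as [n|]; [|contradiction].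
    exists (fun o => o <> Some n), (fun o => o = Some n).
    split; [apply Hco|]. split; [apply one_point_isolated|].
    split; [congruence|]. split; [reflexivity|]. tauto.
Qed.

Definition weight (o : option nat) : R :=
  match o with Some n => / (INR n + 1) | None => 0 end.

(** An ultrametric in which [weight] is the distance to [None]. *)
Definition one_point_dist (o o' : option nat) : R :=
  if excluded_middle_informative (o = o') then 0%R else Rmax (weight o) (weight o').

Lemma weight_some_pos (n : nat) : (0 < weight (Some n))%R.
Proof. apply Rinv_0_lt_compat. pose proof (pos_INR n). lra. Qed.

Lemma weight_nonneg (o : option nat) : (0 <= weight o)%R.
Proof. destruct o as [n|]; [apply Rlt_le, weight_some_pos | apply Rle_refl]. Qed.

Lemma weight_small (eps : R) : (0 < eps)%R ->
  exists N, forall n, N <= n -> (weight (Some n) < eps)%R.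
Proof.
  intros Heps. destruct (archimed_cor1 eps Heps) as (N & HN & HN0). exists N.
  intros n Hn. apply Rle_lt_trans with (2 := HN). apply Rinv_le_contravar.
  - now apply lt_0_INR.
  - apply le_INR in Hn. lra.
Qed.

Lemma one_point_metric : is_metric one_point_dist.
Proof.
  unfold one_point_dist. split; [|split; [|split]].
  - intros x y. destruct excluded_middle_informative; [lra|].
    apply Rle_trans with (1 := weight_nonneg x), Rmax_l.
  - intros x y. destruct excluded_middle_informative as [-> | Hne]; [tauto|].
    split; [|contradiction]. intros H. exfalso.
    pose proof (Rmax_l (weight x) (weight y)). pose proof (Rmax_r (weight x) (weight y)).
    destruct x as [n|]; [pose proof (weight_some_pos n); lra|].
    destruct y as [n|]; [pose proof (weight_some_pos n); lra|]. now apply Hne.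
  - intros x y. do 2 destruct excluded_middle_informative; subst; try contradiction; trivial.
    apply Rmax_comm.
  - intros x y z. pose proof (weight_nonneg x). pose proof (weight_nonneg y).
    pose proof (weight_nonneg z).
    repeat destruct excluded_middle_informative; subst; try contradiction;
      unfold Rmax; repeat destruct Rle_dec; lra.
Qed.

Lemma one_point_separable_metrizable : separable_metrizable one_point.
Proof.
  split.
  - exists one_point_dist. split; [apply one_point_metric|]. intros U. split.
    + intros HU [n|] Ux.
      (* All other points are at least this far from [Some n]. *)
      * exists (weight (Some n)). split; [apply weight_some_pos|]. intros y.
        unfold one_point_dist. destruct excluded_middle_informative as [<- | Hne]; [trivial|].
        intros Hy. pose proof (Rmax_l (weight (Some n)) (weight y)). lra.
      * destruct (HU Ux) as (N & HN). exists (weight (Some N)).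
        split; [apply weight_some_pos|]. intros [n|] Hn; [|assumption].
        apply HN. apply Nat.lt_le_incl, Nat.nle_gt. intros HnN.
        assert (weight (Some N) <= weight (Some n))%R.
        { apply Rinv_le_contravar; [pose proof (pos_INR n); lra|].
          apply le_INR in HnN. lra. }
        unfold one_point_dist in Hn. destruct excluded_middle_informative; [discriminate|].
        pose proof (Rmax_r (weight None) (weight (Some n))). lra.
    + intros HU U0. destruct (HU None U0) as (eps & Heps & Hball).
      destruct (weight_small eps Heps) as (N & HN). exists N. intros n Hn. apply Hball.
      unfold one_point_dist. destruct excluded_middle_informative; [discriminate|].
      apply Rmax_lub_lt; [assumption | now apply HN].
  - exists (fun _ => True). split.
    + exists (fun o => match o with Some n => 1 + n | None => 0 end).
      intros [n|] [m|] _ _ E; simpl in E; congruence.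
    + intros U _ (x & Ux). now exists x.
Qed.

(** * Stone-Cech compactification *)

(** The map [e] factors through the closure of its image. By uniqueness of extensions the identity
    of [B] does too, so this closure is all of [B]. *)
Lemma stone_cech_dense {X : Type} (opX : set X -> Prop) (B : Type) (opB : set B -> Prop)
  (e : X -> B) :
  stone_cech opX B opB e -> dense opB (fun b => exists x, e x = b).
Proof.
  intros (HB & Hc & Hh & Hcont & Huniv).
  set (E := fun b => exists x, e x = b).
  assert (HE : forall x, closure opB E (e x)).
  { intros x. apply subset_closure. now exists x. }
  destruct (Huniv {b | closure opB E b} (subspace opB (closure opB E))
    (fun x => exist _ (e x) (HE x))) as (g & Hg & Hge & _).
  - now apply subspace_topology.
  - apply subspace_compact; [assumption|]. now apply closure_closed.
  - now apply subspace_hausdorff.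
  - now apply continuous_into_subspace.
  - destruct (Huniv B opB e) as (k & _ & _ & Hk); trivial.
    intros U HU (b & Ub).
    assert (Hb : closure opB E b); [|exact (Hb U HU Ub)].
    replace b with (proj1_sig (g b)); [apply proj2_sig|].
    transitivity (k b); [|symmetry].
    + apply (Hk (fun b => proj1_sig (g b))).
      * apply (continuous_comp _ _ _ g _ Hg), subspace_inclusion_continuous.
      * intros x. now rewrite Hge.
    + apply (Hk (fun b => b)); [now intros V HV | trivial].
Qed.

(** A function that is $0$ at [x] and $1$ off [U] extends, after truncation, to [B]; the part of [B]
    where the extension is below $1$ serves as [W]. *)
Lemma stone_cech_embedding {X : Type} (opX : set X -> Prop) (B : Type)
  (opB : set B -> Prop) (e : X -> B) :
  tychonoff opX -> stone_cech opX B opB e ->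
  forall U x, opX U -> U x ->
  exists W, opB W /\ W (e x) /\ forall y, W (e y) -> U y.
Proof.
  intros [_ Hty] (_ & _ & _ & _ & Huniv) U x HU Ux.
  destruct (Hty (fun y => ~ U y) x) as (f & Hf & f0 & f1); [|tauto|].
  { unfold closed. replace (fun y => ~ ~ U y) with U; [assumption|].
    apply set_ext. intros y. split; [tauto | apply NNPP]. }
  destruct (Huniv _ (subspace R_topology unit_interval) (fun y => clamp (f y)))
    as (g & Hg & Hge & _).
  - apply subspace_topology, R_topology_is_topology.
  - apply unit_interval_compact.
  - apply subspace_hausdorff, R_topology_hausdorff.
  - apply (continuous_comp _ _ _ f clamp Hf), clamp_continuous.
  - exists (fun b => (proj1_sig (g b) < 1)%R). split; [|split].
    + exact (continuous_comp _ _ _ g _ Hg (subspace_inclusion_continuous _ _) _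
               (R_topology_lt 1)).
    + rewrite Hge, f0. simpl. unfold Rmax, Rmin. repeat destruct Rle_dec; lra.
    + intros y Hy. apply NNPP. intros Uy. rewrite Hge, (f1 y Uy) in Hy. simpl in Hy.
      unfold Rmax, Rmin in Hy. repeat destruct Rle_dec; lra.
Qed.

(** * Convergent sequences and subsequences *)

Definition converges {X : Type} (op : set X -> Prop) (u : nat -> X) (x : X) : Prop :=
  forall U, op U -> U x -> exists N, forall n, N <= n -> U (u n).

Definition increasing (phi : nat -> nat) : Prop := forall n, phi n < phi (1 + n).

Lemma increasing_lt (phi : nat -> nat) :
  increasing phi -> forall n m, n < m -> phi n < phi m.
Proof. intros Hphi n m Hnm. induction Hnm; [apply Hphi|]. pose proof (Hphi m). simpl in *. lia. Qed.

Lemma increasing_ge (phi : nat -> nat) : increasing phi -> forall n, n <= phi n.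
Proof. intros Hphi n. induction n as [|n IH]; [lia|]. pose proof (Hphi n). simpl in *. lia. Qed.

Lemma increasing_injective (phi : nat -> nat) : increasing phi -> injective phi.
Proof.
  intros Hphi n m E. destruct (Nat.lt_total n m) as [H | [H | H]]; trivial;
    apply (increasing_lt phi Hphi) in H; lia.
Qed.

Lemma increasing_choice (P : nat -> nat -> Prop) :
  (forall k m, exists n, m <= n /\ P k n) ->
  exists phi, increasing phi /\ forall k, P k (phi k).
Proof.
  intros H.
  set (next := fun k m => proj1_sig (constructive_indefinite_description _ (H k m))).
  assert (Hnext : forall k m, m <= next k m /\ P k (next k m)).
  { intros k m. unfold next. apply proj2_sig. }
  set (phi := fix phi k := match k with 0 => next 0 0 | S j => next (S j) (1 + phi j) end).
  exists phi. split.
  - intros n. apply (Hnext (1 + n) (1 + phi n)).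
  - intros [|k]; apply Hnext.
Qed.

(** * Failure of open factorizability for $\beta S$ *)

Section StoneCech.
Context {S : Type} (opS : set S -> Prop) (mul : S -> S -> S) (iota : bicyclic -> S)
  (HS : topological_semigroup opS mul) (Hhaus : hausdorff opS)
  (Hinj : injective iota) (Hhom : semigroup_hom bmul mul iota)
  (Hdense : dense opS (fun s => exists x, iota x = s))
  (B : Type) (opB : set B -> Prop) (e : S -> B) (HSC : stone_cech opS B opB e).

Lemma stone_cech_limit_in_space (c : nat -> bicyclic) (x : B) :
  injective c -> converges opB (fun k => e (iota (c k))) x -> exists s, e s = x.
Proof.
  intros Hc Hx. apply NNPP. intros Hno. pose proof HSC as (HB & HBc & HBh & He & Huniv).
  set (even := fun s => exists k, s = iota (c (2 * k))).
  set (chi := fun s => if excluded_middle_informative (even s) then true else false).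
  (* Separating [e s] from [x] excludes all terms with index at least [N]; the finitely many
     remaining even terms are removed by hand. *)
  assert (Hodd : opS (fun s => ~ even s)).
  { apply open_of_nbhds; [apply HS|]. intros s Hs.
    destruct (HBh (e s) x) as (U & V & HU & HV & Us & Vx & HUV); [eauto|].
    destruct (Hx V HV Vx) as (N & HN).
    exists (fun t => U (e t) /\
             forall y, In y (map (fun k => iota (c k)) (seq 0 N)) -> even y -> t <> y).
    split; [|split].
    - apply open_inter; [apply HS | now apply He |].
      apply open_not_in; [apply HS | assumption].
    - split; [assumption|]. intros y _ Hy ->. contradiction.
    - intros t [Ut Ht] (k & ->). destruct (Nat.lt_ge_cases (2 * k) N) as [Hk | Hk].
      + apply (Ht (iota (c (2 * k)))); trivial.
        * apply in_map_iff. exists (2 * k). split; [reflexivity|]. apply in_seq. lia.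
        * now exists k.
      + apply (HUV (e (iota (c (2 * k))))). split; [assumption | now apply HN]. }
  assert (Heven : opS even).
  { apply (open_in_bicyclic opS mul iota HS Hhaus Hinj Hhom Hdense).
    intros s (k & ->). now exists (c (2 * k)). }
  destruct (Huniv bool (fun _ => True) chi) as (g & Hg & Hge & _).
  - repeat split; trivial.
  - intros F [_ HF]. destruct (HF true) as (U & FU & Ut). destruct (HF false) as (V & FV & Vf).
    exists (U :: V :: nil). split; [now intros W [<- | [<- | []]]|].
    intros [|]; [exists U | exists V]; simpl; auto.
  - intros a b Hab. exists (fun z => z = a), (fun z => z = b).
    repeat split; trivial. intros z [-> ->]. contradiction.
  - intros V _. unfold chi. apply open_of_nbhds; [apply HS|].
    intros s. destruct excluded_middle_informative as [Hs | Hs]; intros Vs.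
    + exists even. repeat split; trivial. intros t Ht.
      destruct excluded_middle_informative; [assumption | contradiction].
    + exists (fun s => ~ even s). repeat split; trivial. intros t Ht.
      destruct excluded_middle_informative; [contradiction | assumption].
  (* Continuity into discrete [bool] makes [g] eventually constant along the sequence, but it takes
     different values at the indices [2 * N] and [1 + 2 * N]. *)
  - destruct (Hx (fun b => g b = g x)) as (N & HN); trivial.
    { now apply (Hg (fun z => z = g x)). }
    pose proof (HN (2 * N)) as H0. pose proof (HN (1 + 2 * N)) as H1.
    rewrite <- H1 in H0 by lia. rewrite !Hge in H0. unfold chi in H0.
    destruct excluded_middle_informative as [_ | Hn]; [|apply Hn; now exists N].
    destruct excluded_middle_informative as [(k & E) | _]; [|discriminate H0; lia].
    apply Hinj, Hc in E. lia.
Qed.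

Definition code (s : S) : option nat :=
  match excluded_middle_informative (exists c, iota c = s) with
  | left H => Some (to_nat (proj1_sig (constructive_indefinite_description _ H)))
  | right _ => None
  end.

Lemma code_iota (c : bicyclic) : code (iota c) = Some (to_nat c).
Proof.
  unfold code. destruct excluded_middle_informative as [H | H].
  - destruct constructive_indefinite_description as [d E]. simpl.
    apply Hinj in E. now subst d.
  - destruct H. now exists c.
Qed.

Lemma code_some (s : S) (n : nat) : code s = Some n -> s = iota (of_nat n).
Proof.
  unfold code. destruct excluded_middle_informative as [H | H]; [|discriminate].
  destruct constructive_indefinite_description as [d E]. simpl. intros [= <-].
  now rewrite cancel_of_to.
Qed.

(** Points of $\mathcal C(p,q)$ are isolated. Around any other point, the finitely many elements
    with code below [N] can be removed. *)
Lemma code_continuous : continuous opS one_point code.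
Proof.
  apply continuous_of_nbhds; [apply HS|]. intros s V HV Vs.
  destruct (code s) as [n|] eqn:Hs.
  - apply code_some in Hs as Hsn. exists (fun t => t = s). split.
    + rewrite Hsn. now apply (bicyclic_isolated opS mul).
    + split; [reflexivity|]. intros t ->. now rewrite Hs.
  - destruct (HV Vs) as (N & HN).
    exists (fun t => forall y, In y (map (fun n => iota (of_nat n)) (seq 0 N)) ->
                               True -> t <> y).
    split; [|split].
    + apply (open_not_in opS (proj1 HS) Hhaus (fun _ => True)).
    + intros y Hy _ ->. apply in_map_iff in Hy. destruct Hy as (n & <- & _).
      now rewrite code_iota in Hs.
    + intros t Ht. destruct (code t) as [n|] eqn:Hn; [|assumption].
      apply HN, Nat.nlt_ge. intros HnN. apply code_some in Hn.
      apply (Ht (iota (of_nat n))); trivial. apply in_map_iff. exists n.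
      split; [reflexivity|]. apply in_seq. lia.
Qed.

(** The fibre of [F] over [Some (to_nat c)] is open, and the only point of $S$ it contains is
    [iota c]. By density no other point of [B] can lie in it. *)
Lemma code_extension_fiber (F : B -> option nat) (b : B) (c : bicyclic) :
  continuous opB one_point F -> (forall s, F (e s) = code s) ->
  F b = Some (to_nat c) -> b = e (iota c).
Proof.
  intros HF HFe Hb. apply NNPP. intros Hne. pose proof HSC as (HB & _ & HBh & _).
  destruct (HBh _ _ Hne) as (U & V & HU & HV & Ub & Vc & HUV).
  destruct (stone_cech_dense _ _ _ _ HSC (fun b => U b /\ F b = Some (to_nat c)))
    as (b' & [Ub' Hb'] & s & <-).
  - apply open_inter; trivial. now apply (HF _ (one_point_isolated (to_nat c))).
  - now exists b.
  - rewrite HFe in Hb'. apply code_some in Hb'. rewrite cancel_of_to in Hb'. subst s.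
    now apply (HUV (e (iota c))).
Qed.

(* The quotient map [p] is one-to-one over the code of [C(p,q)], so openness of [p] lifts
   convergence in the metrizable [K] to convergence in [B]. *)
Lemma openly_factorizable_subsequence (c : nat -> bicyclic) :
  openly_factorizable opB ->
  exists phi x, increasing phi /\ converges opB (fun k => e (iota (c (phi k)))) x.
Proof.
  intros Hof. pose proof HSC as (HB & HBc & HBh & He & Huniv).
  destruct (Huniv _ one_point code one_point_topology one_point_compact
              one_point_hausdorff code_continuous) as (F & HF & HFe & _).
  destruct (Hof _ one_point F one_point_separable_metrizable HF)
    as (K & opK & p & g & ((d & Hd & HdK) & _) & Hp & Hopen & _ & _ & Hfact).
  destruct (compact_sequence_cluster opB (fun k => e (iota (c k))) HBc) as (x & Hx).
  (* The indices are chosen so that the images under [p] converge to [p x] in the metric of [K]. *)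
  destruct (increasing_choice
              (fun k n => (d (p x) (p (e (iota (c n)))) < / (INR k + 1))%R))
    as (phi & Hphi & Hdist).
  { intros k m. pose proof (weight_some_pos k) as Hk. simpl in Hk.
    destruct (Hx (fun b => (d (p x) (p b) < / (INR k + 1))%R)) with (N := m)
      as (n & Hn & Hdn).
    - apply (Hp (fun y => (d (p x) y < / (INR k + 1))%R)). apply HdK.
      intros y Hy. exists (/ (INR k + 1) - d (p x) y)%R. split; [lra|].
      intros z Hz. pose proof (proj2 (proj2 (proj2 Hd)) (p x) y z). lra.
    - now rewrite (proj2 (proj1 (proj2 Hd) _ _) eq_refl).
    - eauto. }
  exists phi, x. split; [assumption|]. intros U HU Ux.
  pose proof (Hopen U HU) as HpU. apply HdK in HpU.
  destruct (HpU (p x)) as (eps & Heps & Hball); [eauto|].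
  destruct (weight_small eps Heps) as (N & HN). exists N. intros n Hn.
  (* Openness of [p] gives [b] in [U] with the same image under [p], hence the same value of [F];
     the fibre lemma then identifies [b] with the term itself. *)
  destruct (Hball (p (e (iota (c (phi n)))))) as (b & Ub & Hb).
  { apply Rlt_trans with (1 := Hdist n), HN, Hn. }
  rewrite <- (code_extension_fiber F b (c (phi n))); trivial.
  now rewrite Hfact, Hb, <- Hfact, HFe, code_iota.
Qed.

Lemma bicyclic_subsequence_converges (c : nat -> bicyclic) :
  tychonoff opS -> openly_factorizable opB -> injective c ->
  exists phi s, increasing phi /\ converges opS (fun k => iota (c (phi k))) s.
Proof.
  intros Hty Hof Hc.
  destruct (openly_factorizable_subsequence c Hof) as (phi & x & Hphi & Hx).
  destruct (stone_cech_limit_in_space (fun k => c (phi k)) x) as (s & <-); trivial.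
  { intros n m E. now apply (increasing_injective phi Hphi), Hc. }
  exists phi, s. split; [assumption|]. intros U HU Us.
  destruct (stone_cech_embedding opS B opB e Hty HSC U s HU Us) as (W & HW & Ws & HWU).
  destruct (Hx W HW Ws) as (N & HN). exists N. auto.
Qed.

(* Along a common subsequence [q^n -> s] and [p^n -> t], so [s t = 1]; then [s] lies in
   [C(p,q)] and is isolated, which is absurd. *)
Lemma stone_cech_not_openly_factorizable : tychonoff opS -> ~ openly_factorizable opB.
Proof.
  intros Hty Hof.
  destruct (bicyclic_subsequence_converges (fun n => (0, n)) Hty Hof)
    as (phi & s & Hphi & Hs).
  { now intros n m [= ->]. }
  (* Extracting from the exponents [phi k] makes both sequences converge along the indices
     [phi (psi k)]. *)
  destruct (bicyclic_subsequence_converges (fun k => (phi k, 0)) Hty Hof)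
    as (psi & t & Hpsi & Ht).
  { intros n m [= E]. now apply (increasing_injective phi Hphi). }
  assert (Hst : mul s t = iota (0, 0)).
  { apply NNPP. intros Hne.
    destruct (mul_nbhds opS mul HS s t (fun x => x <> iota (0, 0)))
      as (U & V & HU & HV & Us & Vt & H); trivial.
    { apply open_neq_point; [apply HS | assumption]. }
    destruct (Hs U HU Us) as (N & HN). destruct (Ht V HV Vt) as (M & HM).
    pose proof (increasing_ge psi Hpsi (N + M)).
    apply (H (iota (0, phi (psi (N + M)))) (iota (phi (psi (N + M)), 0))).
    - apply HN. lia.
    - apply HM. lia.
    - rewrite <- Hhom. f_equal. unfold bmul; simpl. f_equal; lia. }
  destruct (left_factor_bicyclic opS mul iota HS Hhaus Hinj Hhom Hdense s t _ Hst)
    as (c & <-).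
  destruct (Hs _ (bicyclic_isolated opS mul iota HS Hhaus Hinj Hhom Hdense c) eq_refl)
    as (N & HN).
  (* Two consecutive terms equal the isolated limit, contradicting the strict growth of [phi]. *)
  pose proof (HN N (Nat.le_refl N)) as E0. pose proof (HN (1 + N)) as E1.
  rewrite <- E1 in E0 by lia. apply Hinj in E0. injection E0 as E0.
  pose proof (Hphi N) as Hlt. simpl in Hlt. lia.
Qed.

End StoneCech.

Theorem theorem5p1 (S : Type) (opS : set S -> Prop) (mul : S -> S -> S)
  (iota : bicyclic -> S)
  (HS : topological_semigroup opS mul) (Hhaus : hausdorff opS)
  (Hinj : injective iota) (Hhom : semigroup_hom bmul mul iota)
  (Hdense : dense opS (fun s => exists x, iota x = s)) :
  (* (1) S \ C(p,q) is a two-sided ideal *)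
  (forall s t : S, ~ (exists x, iota x = t) ->
     ~ (exists x, iota x = mul s t) /\ ~ (exists x, iota x = mul t s)) /\
  (* (2) D_c is clopen and discrete in S x S *)
  (forall c : bicyclic,
     prod_topology opS opS
       (fun z => exists x y, bmul x y = c /\ z = (iota x, iota y)) /\
     closed (prod_topology opS opS)
       (fun z => exists x y, bmul x y = c /\ z = (iota x, iota y)) /\
     discrete_subspace (prod_topology opS opS)
       (fun z => exists x y, bmul x y = c /\ z = (iota x, iota y))) /\
  (* (3) S x S is not pseudocompact *)
  ~ pseudocompact (prod_topology opS opS) /\
  (* (4) beta S is not openly factorizable when S is Tychonoff *)
  (tychonoff opS ->
     forall (B : Type) (opB : set B -> Prop) (e : S -> B),
       stone_cech opS B opB e -> ~ openly_factorizable opB) /\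
  (* (5) AP(S) is a compact abelian topological group and eta is not injective *)
  (forall (A : Type) (opA : set A -> Prop) (mulA : A -> A -> A) (eta : S -> A),
     ap_compactification opS mul A opA mulA eta ->
     compact_abelian_topological_group opA mulA /\ ~ injective eta).
Proof.
  split; [|split; [|split; [|split]]].
  - intros s t Ht. split; intros (c & E); apply Ht.
    + now apply (right_factor_bicyclic opS mul iota HS Hhaus Hinj Hhom Hdense s t c).
    + now apply (left_factor_bicyclic opS mul iota HS Hhaus Hinj Hhom Hdense t s c).
  - intros c. split; [|split].
    + now apply (fiber_open opS mul iota).
    + now apply (fiber_closed opS mul iota).
    + now apply (fiber_discrete opS mul iota).
  - now apply (square_not_pseudocompact opS mul iota).
  - intros Hty B opB e HSC.
    now apply (stone_cech_not_openly_factorizable opS mul iota) with (e := e).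
  - intros A opA mulA eta. now apply (ap_group opS mul iota).
Qed.
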